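(* Let $n\ge 1$. For the class $\mathcal{G}$ of metric sequential transportation games with $n$ players (and any number $m\ge 2$ of buses), $\mathrm{SPoS}(D,\mathcal{G})=\mathrm{SPoA}(D,\mathcal{G})=n$.
   Context: Transportation game. An instance $\Gamma$ consists of a set of players $N=\{1,\dots,n\}$ ($n\ge 1$), a set of buses $M=\{1,\dots,m\}$ with $m\ge 2$, a complete undirected graph on the vertex set $V=N\cup\{s,t\}$ ($s$ the source, $t$ the destination) with a distance function $d$ assigning a nonnegative real $d(x,y)=d(y,x)$ to each edge (with $d(x,x)=0$), and for each bus $j\in M$ a permutation $\pi_j$ of $N$. The instance is metric if $d(x,w)\le d(x,y)+d(y,w)$ for all $x,y,w\in V$. Distances between distinct vertices may be $0$. An outcome is a map $\sigma:N\to M$, $\sigma_i$ being the bus chosen by player $i$; $\mathcal{P}$ is the set of outcomes. Given $\sigma$, bus $j$ starts at $s$, visits exactly the players $i$ with $\sigma_i=j$, in the order in which they appear in $\pi_j$, and ends at $t$. Let $n_j=|\{i:\sigma_i=j\}|$, let $p^j_i$ be the $i$-th player visited by bus $j$, and put $p^j_{n_j+1}=t$. The cost of the player $p^j_k$ is $c_{p^j_k}(\sigma)=\sum_{l=k}^{n_j} d(p^j_l,p^j_{l+1})$, the distance travelled by her bus from her location to $t$. The social cost function $D$ is $D(\sigma)=\sum_{j=1}^m\sum_{i=1}^{n_j} d(p^j_i,p^j_{i+1})$. Sequential version. Players choose buses in the order $1,2,\dots,n$, each observing all earlier choices. A strategy of player $i$ is a function $\lambda_i$ assigning a bus to each possible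 history $\sigma_{<i}=(\sigma_1,\dots,\sigma_{i-1})\in M^{i-1}$; a strategy profile is $\lambda=(\lambda_1,\dots,\lambda_n)$. Its outcome is the $\sigma$ with $\sigma_i=\lambda_i(\sigma_{<i})$ for all $i$. A strategy profile $\lambda$ is a subgame perfect equilibrium (SPE) if for every player $i$ and every history $\sigma_{<i}$, player $i$ cannot decrease her cost by choosing a bus other than $\lambda_i(\sigma_{<i})$ after the history $\sigma_{<i}$, when players $i+1,\dots,n$ then play according to $\lambda_{i+1},\dots,\lambda_n$. An SPE always exists. For a social cost function $f$, $f(\lambda)$ denotes $f$ of the outcome of $\lambda$. With $\sigma^*\in\mathcal{P}$ minimizing $f$, $\mathrm{SPoA}(f,\Gamma)=\max_{\lambda\in \mathrm{SPE}(\Gamma)} f(\lambda)/f(\sigma^* )$ and $\mathrm{SPoS}(f,\Gamma)=\min_{\lambda\in \mathrm{SPE}(\Gamma)} f(\lambda)/f(\sigma^* )$. For a class $\mathcal{G}$ of games, $\mathrm{SPoA}(f,\mathcal{G})=\sup_{\Gamma\in\mathcal{G}}\mathrm{SPoA}(f,\Gamma)$ and $\mathrm{SPoS}(f,\mathcal{G})=\sup_{\Gamma\in\mathcal{G}}\mathrm{SPoS}(f,\Gamma)$, the suprema being over the $\Gamma\in\mathcal{G}$ with $f(\sigma^* )>0$. *)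

(* Defs.v *)
From HB Require Import structures.
From mathcomp Require Import all_boot all_order all_algebra perm.
From mathcomp Require Import boolp classical_sets reals constructive_ereal ereal.
Set Implicit Arguments.
Unset Strict Implicit.
Unset Printing Implicit Defensive.
Import Order.TTheory GRing.Theory Num.Theory.
Local Open Scope classical_set_scope.
Local Open Scope ring_scope.

(* Players and buses are numbered from 0. *)

Inductive vertex (n : nat) := Player of 'I_n | Source | Dest.
Arguments Source {n}.
Arguments Dest {n}.

(* [visit_order j k] is the [k]-th entry of the permutation of bus [j]. *)
Record game (R : realType) (n : nat) := Game {
  buses : nat;
  buses_gt1 : (1 < buses)%N;
  dist : vertex n -> vertex n -> R;
  dist_ge0 : forall x y, 0 <= dist x y;
  dist_sym : forall x y, dist x y = dist y x;
  dist_diag : forall x, dist x x = 0;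
  visit_order : 'I_buses -> {perm 'I_n} }.

Definition metric (R : realType) (n : nat) (G : game R n) : Prop :=
  forall x y w, dist G x w <= dist G x y + dist G y w.

Definition metric_games (R : realType) (n : nat) : set (game R n) :=
  [set G | metric G].

Section Game.
Variables (R : realType) (n : nat) (G : game R n).

Definition bus := 'I_(buses G).

Definition bus0 : bus := Ordinal (ltnW (buses_gt1 G)).

Definition outcome := {ffun 'I_n -> bus}.

Definition route (sigma : outcome) (j : bus) : seq 'I_n :=
  [seq i <- [seq visit_order j k | k <- enum 'I_n] | sigma i == j].

(* The default value of [nth] supplies the final stop: position
   [size (route sigma j)] is [Dest]. *)
Definition stop (sigma : outcome) (j : bus) (l : nat) : vertex n :=
  nth Dest (map (@Player n) (route sigma j)) l.

Definition cost (sigma : outcome) (i : 'I_n) : R :=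
  let r := route sigma (sigma i) in
  \sum_(index i r <= l < size r)
    dist G (stop sigma (sigma i) l) (stop sigma (sigma i) l.+1).

Definition history (k : nat) := k.-tuple bus.

Definition profile :=
  {dffun forall i : 'I_n, {ffun history i -> bus}}.

(* One move of the player whose turn it is after the choices [h]; the identity
   when all [n] players have moved. *)
Definition move (lambda : profile) (h : seq bus) : seq bus :=
  match @idP (size h < n)%N with
  | ReflectT lt_hn => rcons h (lambda (Ordinal lt_hn) (in_tuple h))
  | ReflectF _ => h
  end.

(* The default [bus0] is never reached, as the play has [n] moves
   whenever [size h <= n]. *)
Definition outcome_after (lambda : profile) (h : seq bus) : outcome :=
  [ffun i : 'I_n => nth bus0 (iter (n - size h) (move lambda) h) i].

Definition outcome_of (lambda : profile) : outcome :=
  outcome_after lambda [::].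

Definition SPE (lambda : profile) : bool :=
  [forall i : 'I_n, forall h : history i, forall b : bus,
    cost (outcome_after lambda (rcons h (lambda i h))) i
      <= cost (outcome_after lambda (rcons h b)) i].

End Game.

Definition social_cost (R : realType) (n : nat) :=
  forall G : game R n, outcome G -> R.

(* The leg from [Source] to the first player is deliberately not counted. *)
Definition total_distance (R : realType) (n : nat) : social_cost R n :=
  fun G sigma =>
    \sum_(j : bus G) \sum_(0 <= l < size (route sigma j))
      dist G (stop sigma j l) (stop sigma j l.+1).

Section Prices.
Variables (R : realType) (n : nat) (f : social_cost R n).

Definition optimum (G : game R n) : outcome G :=
  [arg min_(sigma < [ffun=> bus0 G] : outcome G) f sigma]%O.

Definition ratio (G : game R n) (lambda : profile G) : R :=
  f (outcome_of lambda) / f (optimum G).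

(* Every game has an SPE, so the neutral elements of the extremum over the
   finite set of SPEs are never the value of [SPoA] or [SPoS]. *)
Definition SPoA (G : game R n) : \bar R :=
  \big[maxe/-oo%E]_(lambda : profile G | SPE lambda) (ratio lambda)%:E.

Definition SPoS (G : game R n) : \bar R :=
  \big[mine/+oo%E]_(lambda : profile G | SPE lambda) (ratio lambda)%:E.

Definition SPoA_class (C : set (game R n)) : \bar R :=
  ereal_sup [set SPoA G | G in [set G | C G /\ 0 < f (optimum G)]].

Definition SPoS_class (C : set (game R n)) : \bar R :=
  ereal_sup [set SPoS G | G in [set G | C G /\ 0 < f (optimum G)]].

End Prices.

(* Main.v *)
(* Upper bound: for metric distances no two vertices other than [Source] are
   further apart than the total distance of any outcome, and an outcome has
   one leg per player, so every outcome costs at most [n] times the optimum.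
   Lower bound: put the players in a cluster of diameter [e] at distance 1
   from [Dest], with more buses than players, all visiting later movers first.
   In every SPE each player takes an empty bus, for a total of at least [n],
   while a single bus for everyone travels at most [1 + n * e]. *)

Require Import Defs.
From mathcomp Require Import all_boot all_order all_algebra perm.
From mathcomp Require Import boolp classical_sets reals constructive_ereal ereal.
From mathcomp Require Import lra.
Import Order.TTheory GRing.Theory Num.Theory.
Local Open Scope ring_scope.

(** * Routes, and the comparison of two outcomes in a metric game *)

Section Routes.
Context {R : realType} {n : nat} {G : game R n}.
Implicit Types (sigma tau : outcome G) (j : bus G) (i k : 'I_n).

Lemma mem_route sigma j i : (i \in route sigma j) = (sigma i == j).
Proof.
rewrite mem_filter; case: eqP => //= _.
by apply/mapP; exists ((visit_order j)^-1%g i); rewrite ?mem_enum ?permKV.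
Qed.

Lemma route_uniq sigma j : uniq (route sigma j).
Proof. by rewrite filter_uniq // map_inj_uniq ?enum_uniq //; exact: perm_inj. Qed.

Lemma sum_size_route sigma : (\sum_(j : bus G) size (route sigma j) = n)%N.
Proof.
transitivity (\sum_(j : bus G) \sum_(i < n | sigma i == j) 1)%N.
  apply: eq_bigr => j _; rewrite sum1_card -(card_uniqP (route_uniq sigma j)).
  by apply: eq_card => i; rewrite mem_route.
rewrite -[RHS]card_ord -[RHS]sum1_card.
by rewrite [RHS](partition_big (sigma : 'I_n -> bus G) xpredT).
Qed.

Lemma stop_index sigma i :
  stop sigma (sigma i) (index i (route sigma (sigma i))) = Player i.
Proof.
have iP : i \in route sigma (sigma i) by rewrite mem_route.
by rewrite /stop (nth_map i) ?index_mem ?nth_index.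
Qed.

Lemma stop_player sigma j l i : (l < size (route sigma j))%N ->
  stop sigma j l = Player (nth i (route sigma j) l).
Proof. by move=> lt_l; rewrite /stop (nth_map i). Qed.

Lemma stop_size sigma j : stop sigma j (size (route sigma j)) = Dest.
Proof. by rewrite /stop nth_default ?size_map. Qed.

Let bus_distance sigma j := \sum_(0 <= l < size (route sigma j))
  dist G (stop sigma j l) (stop sigma j l.+1).

Let bus_distance_ge0 sigma j : 0 <= bus_distance sigma j.
Proof. by apply: sumr_ge0 => l _; exact: dist_ge0. Qed.

Lemma dist_stop_sum sigma j a b : metric G -> (a <= b)%N ->
  dist G (stop sigma j a) (stop sigma j b)
    <= \sum_(a <= l < b) dist G (stop sigma j l) (stop sigma j l.+1).
Proof.
move=> metricG; elim: b => [|b IH].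
  by rewrite leqn0 => /eqP ->; rewrite dist_diag big_geq.
rewrite leq_eqVlt => /predU1P[->|]; first by rewrite dist_diag big_geq.
rewrite ltnS => le_ab; rewrite big_nat_recr //=.
exact: le_trans (metricG _ (stop sigma j b) _) (lerD (IH le_ab) (lexx _)).
Qed.

Lemma dist_stop_le sigma j a b : metric G -> (a <= b <= size (route sigma j))%N ->
  dist G (stop sigma j a) (stop sigma j b) <= bus_distance sigma j.
Proof.
move=> metricG /andP[le_ab le_b]; apply: le_trans (dist_stop_sum _ _ _ _ metricG le_ab) _.
rewrite /bus_distance.
rewrite [leRHS](big_cat_nat (n := a)) ?(leq_trans le_ab) //=.
rewrite (big_cat_nat (n := b) (m := a) (p := size _)) //=.
rewrite addrCA lerDl; apply: addr_ge0; apply: sumr_ge0 => l _; exact: dist_ge0.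
Qed.

Lemma dist_player_dest_le sigma i : metric G ->
  dist G (Player i) Dest <= bus_distance sigma (sigma i).
Proof.
move=> metricG; rewrite -[X in dist G X](stop_index sigma) -(stop_size sigma (sigma i)).
by rewrite dist_stop_le // leqnn andbT index_size.
Qed.

Lemma bus_distance_le sigma j : bus_distance sigma j <= total_distance sigma.
Proof.
rewrite /total_distance (bigD1 j) //= lerDl; apply: sumr_ge0 => j' _.
exact: bus_distance_ge0.
Qed.

(** Players on one bus are joined by a stretch of its route. Players on different buses are joined
    through [Dest], and each of the two buses pays for its own half. *)
Lemma dist_players_le sigma i k : metric G ->
  dist G (Player i) (Player k) <= total_distance sigma.
Proof.
move=> metricG; have [eq_ik|neq_ik] := eqVneq (sigma i) (sigma k).
  apply: le_trans (bus_distance_le sigma (sigma i)).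
  wlog le_ik : i k eq_ik / (index i (route sigma (sigma i))
                            <= index k (route sigma (sigma i)))%N.
    move=> H; have /orP[|le_ki] := leq_total (index i (route sigma (sigma i)))
                             (index k (route sigma (sigma i))).
      exact: H.
    by rewrite dist_sym eq_ik; apply: H; rewrite -eq_ik.
  rewrite -(stop_index sigma i) -(stop_index sigma k) -eq_ik dist_stop_le //.
  by rewrite le_ik index_size.
apply: le_trans (metricG _ Dest _) _; rewrite [dist G Dest _]dist_sym.
apply: le_trans (lerD (dist_player_dest_le sigma i metricG)
                      (dist_player_dest_le sigma k metricG)) _.
rewrite /total_distance (bigD1 (sigma i)) //= lerD2l.
rewrite (bigD1 (sigma k)) 1?eq_sym //= lerDl.
by apply: sumr_ge0 => j _; exact: bus_distance_ge0.
Qed.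

Lemma total_distance_le sigma tau : metric G ->
  total_distance sigma <= n%:R * total_distance tau.
Proof.
(* The factor [n] is distributed over the buses of [sigma], one copy of [total_distance tau] for
   each leg. *)
move=> metricG; have -> : n%:R * total_distance tau
    = \sum_(j : bus G) total_distance tau *+ size (route sigma j).
  by rewrite sumrMnr sum_size_route mulr_natl.
apply: ler_sum => j _.
rewrite -[X in _ *+ X]subn0 -sumr_const_nat.
apply: ler_sum_nat => l /andP[_ lt_l].
(* A nonempty route provides a player to serve as default of [nth]. *)
have i0 : 'I_n by case: (route sigma j) lt_l.
rewrite (stop_player _ _ _ i0) //.
have [->|neq_l] := eqVneq l.+1 (size (route sigma j)).
  rewrite stop_size.
  exact: le_trans (dist_player_dest_le tau _ metricG) (bus_distance_le _ _).
rewrite (stop_player _ _ _ i0) ?dist_players_le //.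
by rewrite ltn_neqAle neq_l.
Qed.

End Routes.

(** * Plays of a profile, and existence of equilibria by backward induction *)

Section Play.
Context {R : realType} {n : nat} {G : game R n}.
Implicit Types (lambda mu : profile G) (h : seq (bus G)).

Lemma move_tuple lambda (i : 'I_n) (h : history G i) :
  move lambda h = rcons h (lambda i h).
Proof.
(* Once the length of the history is literally [size s], the two ordinals differ only in their bound
   proofs. *)
case: i h => k lt_kn [s eq_s]; have /= E := eqP eq_s; subst k.
rewrite /move /=; case: {-}_ / idP => [lt_sn|//].
rewrite (bool_irrelevance lt_sn lt_kn); congr (rcons s (lambda _ _)).
exact: val_inj.
Qed.

Lemma move_ge lambda h : (n <= size h)%N -> move lambda h = h.
Proof.
move=> le_n; rewrite /move; case: {-}_ / idP => // lt_n.
by have := leq_trans lt_n le_n; rewrite ltnn.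
Qed.

Lemma move_lt lambda h : (size h < n)%N -> exists b, move lambda h = rcons h b.
Proof. by move=> lt_n; rewrite /move; case: {-}_ / idP => // lt; eexists. Qed.

Lemma size_play lambda k : (k <= n)%N -> size (iter k (move lambda) [::]) = k.
Proof.
elim: k => //= k IH lt_kn; have sz := IH (ltnW lt_kn).
by have [|b ->] := move_lt lambda (iter k (move lambda) [::]); rewrite ?size_rcons sz.
Qed.

Lemma nth_iter_move lambda h k l x0 : (l < size h)%N ->
  nth x0 (iter k (move lambda) h) l = nth x0 h l.
Proof.
move=> lt_l; suff [_ ->] : (size h <= size (iter k (move lambda) h))%N /\
    nth x0 (iter k (move lambda) h) l = nth x0 h l by [].
elim: k => //= k [le_h IH].
case: (ltnP (size (iter k (move lambda) h)) n) => [lt_n|/move_ge-> //].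
have [b ->] := move_lt lambda _ lt_n; rewrite size_rcons nth_rcons IH.
by rewrite (leq_trans lt_l le_h); split=> //; exact: leqW.
Qed.

Lemma outcome_after_nth lambda h (i : 'I_n) : (i < size h)%N ->
  outcome_after lambda h i = nth (bus0 G) h i.
Proof. by move=> lt_i; rewrite ffunE nth_iter_move. Qed.

Lemma outcome_after_move lambda h : (size h < n)%N ->
  outcome_after lambda (move lambda h) = outcome_after lambda h.
Proof.
move=> lt_h; apply/ffunP => i; rewrite !ffunE; have [b eq_b] := move_lt lambda h lt_h.
by rewrite {1}eq_b size_rcons -iterSr subnSK.
Qed.

Lemma outcome_after_play lambda k : (k <= n)%N ->
  outcome_after lambda (iter k (move lambda) [::]) = outcome_of lambda.
Proof.
elim: k => // k IH lt_kn; rewrite -IH 1?ltnW //=.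
by rewrite outcome_after_move // size_play // ltnW.
Qed.

(** The play after [h] consults only the players still to move, so redefining an earlier strategy
    leaves the later subgames intact. *)
Lemma eq_outcome_after lambda mu h :
    (forall i : 'I_n, (size h <= i)%N -> lambda i = mu i) ->
  outcome_after lambda h = outcome_after mu h.
Proof.
move=> eq_lm; apply/ffunP => i; rewrite !ffunE; congr nth.
move: (n - size h)%N => m; elim: m h eq_lm => // k IH h eq_lm; rewrite !iterSr.
have -> : move lambda h = move mu h.
  rewrite /move; case: {-}_ / idP => // lt_h.
  by rewrite eq_lm.
apply: IH => l; case: (ltnP (size h) n) => [lt_h|/move_ge-> /eq_lm//].
have [b ->] := move_lt mu _ lt_h.
by rewrite size_rcons => /ltnW/eq_lm.
Qed.

Definition no_gain lambda (i : 'I_n) := [forall h : history G i, forall b : bus G,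
  cost (outcome_after lambda (rcons h (lambda i h))) i
    <= cost (outcome_after lambda (rcons h b)) i].

(** Backward induction: from a profile optimal for the players after [k], let player [k] best
    respond at every history. *)
Lemma no_gain_after k : exists lambda, [forall i : 'I_n, (k <= i)%N ==> no_gain lambda i].
Proof.
have [d] := ubnP (n - k)%N; elim: d k => // d IH k.
case: (leqP n k) => [le_nk _|lt_kn lt_d].
  exists [ffun i => [ffun => bus0 G]]; apply/forallP => i; apply/implyP => le_ki.
  by have := leq_ltn_trans le_ki (ltn_ord i); rewrite ltnNge le_nk.
have [|lambda /forallP opt_lambda] := IH k.+1.
  by rewrite -ltnS (leq_trans _ lt_d) // ltnS ltn_sub2l.
pose F (i : 'I_n) (h : history G i) b := cost (outcome_after lambda (rcons h b)) i.
pose mu : profile G := [ffun i : 'I_n =>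
  if val i == k then [ffun h : history G i => [arg min_(b < bus0 G) F i h b]%O]
  else lambda i].
(* After the choice of a player [i] with [k <= i], only players beyond [k] move, and for these [mu]
   and [lambda] agree. *)
have eq_mu (i : 'I_n) (h : history G i) b : (k <= i)%N ->
    outcome_after mu (rcons h b) = outcome_after lambda (rcons h b).
  move=> le_ki; apply: eq_outcome_after => l; rewrite size_rcons size_tuple => lt_il.
  by rewrite ffunE gtn_eqF // (leq_ltn_trans le_ki).
exists mu; apply/forallP => i; apply/implyP => le_ki.
apply/forallP => h; apply/forallP => b; rewrite !eq_mu //.
rewrite ffunE; case: eqP => [_|/eqP neq_ik].
  by rewrite ffunE; case: arg_minP => // b' _; exact.
have /implyP := opt_lambda i; rewrite ltn_neqAle eq_sym neq_ik => /(_ le_ki).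
by move=> /forallP/(_ h)/forallP/(_ b).
Qed.

Lemma SPE_exists : exists lambda : profile G, SPE lambda.
Proof.
have [lambda /forallP opt] := no_gain_after 0.
by exists lambda; apply/forallP => i; exact: (implyP (opt i)).
Qed.

End Play.

(** * The cluster game: its equilibria and its cheap one-bus outcome *)

Section Cluster.
Context {R : realType} {n : nat}.
Hypothesis n_gt0 : (0 < n)%N.
Variable e : R.
Hypotheses (e_gt0 : 0 < e) (e_le1 : e <= 1).

Definition cluster_dist (x y : vertex n) : R :=
  match x, y with
  | Player i, Player k => if i == k then 0 else e
  | Source, Source | Dest, Dest => 0
  | _, _ => 1
  end.

Lemma cluster_dist_ge0 x y : 0 <= cluster_dist x y.
Proof. by case: x y => [i||] [k||] //=; case: eqP => // _; exact: ltW. Qed.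

Lemma cluster_dist_sym x y : cluster_dist x y = cluster_dist y x.
Proof. by case: x y => [i||] [k||] //=; rewrite eq_sym. Qed.

Lemma cluster_dist_diag x : cluster_dist x x = 0.
Proof. by case: x => [i||] //=; rewrite eqxx. Qed.

(* All buses visit the players in decreasing order, so that the cost of a
   player depends only on the choices of the players who moved before her;
   with more buses than players, she always finds an empty one. *)
Definition cluster : game R n :=
  Game (n_gt0 : 1 < n.+1)%N cluster_dist_ge0 cluster_dist_sym cluster_dist_diag
    (fun=> perm rev_ord_inj).

Lemma metric_cluster : metric cluster.
Proof.
have [e0 e1] := (e_gt0, e_le1).
move=> x y w /=; case: x y w => [i||] [k||] [l||] //=; try by do ?case: eqP => _; lra.
by case: (eqVneq i k) => [->|_]; do ?case: eqP => _; lra.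
Qed.

Implicit Types (sigma : outcome cluster) (j : bus cluster) (i k : 'I_n).

Lemma route_decreasing sigma j i a b : (a < b < size (route sigma j))%N ->
  (nth i (route sigma j) b < nth i (route sigma j) a)%N.
Proof.
have gt_trans : transitive (fun i k : 'I_n => (k < i)%N).
  by move=> l k m lt_lk /ltn_trans; apply.
case/andP=> lt_ab lt_b.
apply: (sorted_ltn_nth gt_trans) => //; rewrite ?inE ?(ltn_trans lt_ab) //.
apply: sorted_filter => //; rewrite sorted_map.
have : sorted ltn (map val (enum 'I_n)) by rewrite val_enum_ord iota_ltn_sorted.
rewrite sorted_map; apply: sub_sorted => k l /= lt_kl.
by rewrite !permE /= ltn_sub2l // (leq_ltn_trans lt_kl).
Qed.

(** Routes decrease, so the earliest mover on a bus is visited last and rides straight to [Dest]. *)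
Lemma cost_first_mover sigma i : (forall k, sigma k = sigma i -> (i <= k)%N) ->
  cost sigma i = 1.
Proof.
move=> first_i; rewrite /cost; set r := route sigma (sigma i).
have ltr : (index i r < size r)%N by rewrite index_mem mem_route.
suff last_i : (index i r).+1 = size r.
  by rewrite -last_i big_nat1 stop_index last_i stop_size.
apply/eqP; rewrite eqn_leq ltr leqNgt; apply/negP => lt_next.
have := route_decreasing sigma (sigma i) i (index i r) (index i r).+1.
rewrite leqnn lt_next nth_index -?index_mem // => /(_ isT); rewrite ltnNge first_i //.
by apply/eqP; rewrite -mem_route mem_nth.
Qed.

(** Player [k] is visited after [i], so [i] first rides [e] to another player; by the triangle
    inequality the rest is at least that player's distance 1 to [Dest]. *)
Lemma cost_shared sigma i k : sigma k = sigma i -> (k < i)%N -> 1 + e <= cost sigma i.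
Proof.
move=> eq_ki lt_ki; rewrite /cost; set r := route sigma (sigma i).
have ir : i \in r by rewrite mem_route.
have kr : k \in r by rewrite mem_route eq_ki.
have lt_ik : (index i r < index k r)%N.
  rewrite ltnNge leq_eqVlt; apply/negP => /predU1P[eq_ind|lt_ind].
    by move: lt_ki; rewrite -(nth_index i ir) -eq_ind nth_index // ltnn.
  have := route_decreasing sigma (sigma i) i (index k r) (index i r).
  by rewrite lt_ind index_mem ir !nth_index // => /(_ isT); rewrite ltnNge ltnW.
have lt_next : ((index i r).+1 < size r)%N by rewrite (leq_ltn_trans lt_ik) ?index_mem.
rewrite big_ltn ?index_mem // addrC lerD //.
  rewrite stop_index (stop_player _ _ _ i) //=; case: eqP => // eq_i.
  have := route_decreasing sigma (sigma i) i (index i r) (index i r).+1.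
  by rewrite leqnn lt_next -/r -eq_i nth_index // ltnn => /(_ isT).
have := dist_stop_sum sigma (sigma i) _ _ metric_cluster (ltnW lt_next).
by rewrite stop_size (stop_player _ _ _ i).
Qed.

Lemma SPE_cluster_inj (lambda : profile cluster) : SPE lambda ->
  injective (outcome_of lambda).
Proof.
move=> /forallP SPElambda; set sigma := outcome_of lambda.
suff no_share i k : (k < i)%N -> sigma k <> sigma i.
  move=> i k eq_ik; apply/val_inj; case: (ltngtP i k) => // lt_ik.
    by case: (no_share k i lt_ik).
  by case: (no_share i k lt_ik).
move=> lt_ki eq_ki.
have sz_h := size_play lambda _ (ltnW (ltn_ord i)).
(* The deviation is tested at the history reached on the equilibrium path. *)
pose h : history cluster i := Tuple (introT eqP sz_h).
(* Pigeonhole: [i] earlier choices cannot cover [n.+1] buses. *)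
have [b b_new] : exists b : bus cluster, b \notin h.
  apply/existsP; rewrite -negb_forall; apply/negP => /forallP all_h.
  have := card_size h; rewrite size_tuple.
  have -> : #|h| = #|bus cluster| by apply: eq_card => b; rewrite all_h.
  by rewrite card_ord ltnNge (leq_trans (ltnW (ltn_ord i))).
have := forallP (forallP (SPElambda i) h) b.
rewrite -move_tuple outcome_after_move ?sz_h // outcome_after_play ?(ltnW (ltn_ord i)) //.
rewrite (cost_first_mover (outcome_after lambda (rcons h b))) => [|l].
  have := e_gt0; have := cost_shared sigma i k eq_ki lt_ki; rewrite -/sigma; lra.
(* It remains that [i] is the first mover on [b]: an earlier one would put [b] in [h]. *)
rewrite (outcome_after_nth lambda _ i) ?size_rcons ?size_tuple //.
rewrite nth_rcons size_tuple ltnn eqxx => eq_lb; rewrite leqNgt; apply/negP => lt_li.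
move: eq_lb; rewrite outcome_after_nth ?size_rcons ?size_tuple ?(leqW lt_li) //.
rewrite nth_rcons size_tuple lt_li => eq_lb.
by rewrite -eq_lb mem_nth ?size_tuple in b_new.
Qed.

(** Every nonempty route is a single player travelling distance 1, so the bound holds bus by bus. *)
Lemma total_distance_inj sigma : injective sigma -> n%:R <= total_distance sigma.
Proof.
move=> inj_sigma; rewrite -[X in X%:R](sum_size_route sigma) natr_sum.
apply: ler_sum => j _; case def_r: (route sigma j) => [|i r]; first by rewrite big_geq.
have def_j : sigma i = j by apply/eqP; rewrite -mem_route def_r mem_head.
case: r def_r => [|k r] def_r.
  have := stop_size sigma j; rewrite big_nat1 def_r /= => ->.
  by rewrite (stop_player _ _ _ i) def_r.
have def_k : sigma k = j by apply/eqP; rewrite -mem_route def_r !inE eqxx orbT.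
have := route_uniq sigma j; rewrite def_r /= inE.
by rewrite (inj_sigma i k) ?eqxx // def_j.
Qed.

Lemma total_distance_one_bus :
  total_distance ([ffun=> bus0 cluster] : outcome cluster) <= 1 + n%:R * e.
Proof.
set sigma : outcome cluster := [ffun=> bus0 cluster].
have empty j : j != bus0 cluster -> size (route sigma j) = 0%N.
  move=> neq_j; case def_r: (route sigma j) => [|i r] //.
  have : i \in route sigma j by rewrite def_r mem_head.
  by rewrite mem_route ffunE eq_sym (negbTE neq_j).
rewrite /total_distance (bigD1 (bus0 cluster)) //= [X in _ + X]big1 => [|j neq_j]; last first.
  by rewrite empty // big_geq.
have sz : size (route sigma (bus0 cluster)) = n.
  rewrite -[RHS](sum_size_route sigma) (bigD1 (bus0 cluster)) //= big1 ?addn0 //.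
have i0 : 'I_n by exists 0%N.
have sz1 : size (route sigma (bus0 cluster)) = n.-1.+1 by rewrite sz prednK.
rewrite addr0 sz1 big_nat_recr //= -sz1 stop_size (stop_player _ _ _ i0) ?sz1 //=.
rewrite addrC lerD2l.
have -> : n%:R * e = \sum_(0 <= l < n) e by rewrite sumr_const_nat subn0 mulr_natl.
(* Only [n.-1] legs join two players; the last copy of [e] is slack. *)
rewrite -[X in _ <= \sum_(_ <= _ < X) _](prednK n_gt0) big_nat_recr //=.
apply: ler_wpDr; first exact: ltW.
apply: ler_sum_nat => l /andP[_ lt_l].
rewrite !(stop_player _ _ _ i0) ?sz1 ?ltnS ?(ltnW lt_l) //=.
by case: eqP => // _; exact: ltW.
Qed.

End Cluster.

(** * Bounds on the prices of anarchy and stability *)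

Section Prices.
Context {R : realType} {n : nat}.
Let D := @total_distance R n.

Lemma optimum_le (f : social_cost R n) (G : game R n) (sigma : outcome G) :
  f G (optimum f G) <= f G sigma.
Proof. by rewrite /optimum; case: arg_minP => // tau _; exact. Qed.

Lemma ratio_le (G : game R n) (lambda : profile G) : metric G -> 0 < D _ (optimum D G) ->
  Defs.ratio D lambda <= n%:R.
Proof. by move=> metricG opt_gt0; rewrite /Defs.ratio ler_pdivrMr // total_distance_le. Qed.

(** Rests on the existence of an SPE: over no profile at all, the minimum is [+oo] and the maximum
    [-oo]. *)
Lemma SPoS_le_SPoA (f : social_cost R n) (G : game R n) : (SPoS f G <= SPoA f G)%E.
Proof.
have [lambda SPElambda] := @SPE_exists R n G.
apply: (@le_trans _ _ (Defs.ratio f lambda)%:E).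
  exact: (bigmin_le_cond _ (fun mu => (Defs.ratio f mu)%:E)).
exact: (le_bigmax_cond _ (fun mu => (Defs.ratio f mu)%:E)).
Qed.

Lemma SPoA_metric_le (G : game R n) : metric G -> 0 < D _ (optimum D G) ->
  (SPoA D G <= n%:R%:E)%E.
Proof.
move=> metricG opt_gt0; apply: bigmax_le => [|lambda _]; first exact: leNye.
by rewrite lee_fin ratio_le.
Qed.

(** In a cluster of diameter [d] every SPE has ratio at least [n / (1 + n * d)], which tends to [n]
    as [d] tends to 0. *)
Lemma SPoS_metric_unbounded (e : R) : (0 < n)%N -> 0 < e ->
  exists2 G : game R n, metric G /\ 0 < D _ (optimum D G) & ((n%:R - e)%:E <= SPoS D G)%E.
Proof.
move=> n_gt0 e_gt0; pose N : R := n%:R.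
have N_ge1 : 1 <= N by rewrite ler1n.
have M_gt0 : 0 < N * N + e by nra.
(* Chosen so that [N * N * d = e - e * d], whence [(N - e) * (1 + N * d) = N - e * d - e * (N * d)
   <= N]. *)
pose d := e / (N * N + e).
have d_gt0 : 0 < d by rewrite divr_gt0.
have defd : d * (N * N + e) = e by rewrite divfK // gt_eqF.
have d_le1 : d <= 1 by nra.
pose G := cluster n_gt0 d d_gt0.
have metricG : metric G by exact: metric_cluster.
have opt_le : D _ (optimum D G) <= 1 + N * d.
  exact: le_trans (optimum_le _ _ _) (total_distance_one_bus _ _ _).
have D_SPE (lambda : profile G) : SPE lambda -> N <= D _ (outcome_of lambda).
  by move=> SPElambda; apply/total_distance_inj/SPE_cluster_inj.
(* An SPE costs at least [N > 0] and at most [N] times the optimum. *)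
have opt_gt0 : 0 < D _ (optimum D G).
  have [lambda SPElambda] := @SPE_exists R n G.
  have := total_distance_le (outcome_of lambda) (optimum D G) metricG.
  have := D_SPE _ SPElambda; rewrite -/N -/D; nra.
exists G => //; apply: le_bigmin => [|lambda SPElambda]; first exact: leey.
rewrite lee_fin /Defs.ratio ler_pdivlMr //; apply: le_trans (D_SPE _ SPElambda).
rewrite -/N; case: (lerP (N - e) 0) => [le0|gt0].
  by apply: (@le_trans _ _ 0); nra.
apply: (@le_trans _ _ ((N - e) * (1 + N * d))); first by rewrite ler_wpM2l // ltW.
have ed_gt0 : 0 < e * d by exact: mulr_gt0.
have eNd_ge0 : 0 <= e * (N * d) by rewrite mulrCA mulr_ge0 ?ler0n // ltW.
lra.
Qed.

End Prices.

Theorem corollary3p3 (R : realType) (n : nat) (n_ge1 : (1 <= n)%N) :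
  SPoS_class (@total_distance R n) (@metric_games R n) = (n%:R)%:E /\
  SPoA_class (@total_distance R n) (@metric_games R n) = (n%:R)%:E.
Proof.
have SPoA_le : (SPoA_class (@total_distance R n) (@metric_games R n) <= n%:R%:E)%E.
  by apply: ge_ereal_sup => _ [G [metricG opt_gt0] <-]; exact: SPoA_metric_le.
have SPoS_ge : (n%:R%:E <= SPoS_class (@total_distance R n) (@metric_games R n))%E.
  (* Each cluster game is only used to come within [e] of [n], so the bound is proved up to every
     positive [e]. *)
  apply/lee_addgt0Pr => e e_gt0.
  have [G good_G ge_G] := SPoS_metric_unbounded e n_ge1 e_gt0.
  rewrite -leeBlDr // -EFinB; apply: le_trans ge_G _.
  by apply: ereal_sup_ubound; exists G.
have SPoS_le : (SPoS_class (@total_distance R n) (@metric_games R n)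
                <= SPoA_class (@total_distance R n) (@metric_games R n))%E.
  apply: ge_ereal_sup => _ [G good_G <-]; apply: le_trans (SPoS_le_SPoA _ _) _.
  by apply: ereal_sup_ubound; exists G.
(* Both equalities follow from the chain [n <= SPoS <= SPoA <= n] for the class. *)
split; apply/eqP; rewrite eq_le.
  by rewrite SPoS_ge (le_trans SPoS_le).
by rewrite SPoA_le (le_trans SPoS_ge).
Qed.
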